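(* Let $p$ be a fixed odd prime. For even $n$, the number of powerful $p$-groups of type $(2,\ldots,2)$ and order $p^n$, up to isomorphism, is $$p^{\frac1{16}n^3+o(n^3)}\quad\text{as } n\to\infty \text{ through even integers}.$$
   Context: A finite $p$-group $G$ is powerful if $[G,G]\le G^p$, where $G^p$ is the subgroup generated by all $p$-th powers. Every powerful $p$-group $G$ has a powerful basis, i.e. generators $a_1,\ldots,a_r$ with $G=\langle a_1\rangle\cdots\langle a_r\rangle$ and $|G|=o(a_1)\cdots o(a_r)$; the number of generators of each order is an invariant of $G$. $G$ is of type $(2,\ldots,2)$ if all the generators in a powerful basis have order $p^2$. *)

(* Defs.v *)
From HB Require Import structures.
From mathcomp Require Import all_boot all_fingroup all_solvable.
From mathcomp Require Import boolp.

Set Implicit Arguments.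
Unset Strict Implicit.
Unset Printing Implicit Defensive.

Local Open Scope group_scope.

(* The usual definition for odd p (for p = 2 one requires [G, G] <= G^4). *)
Definition powerful (p : nat) (gT : finGroupType) (G : {group gT}) : bool :=
  p.-group G && ([~: G, G] \subset <<[set x ^+ p | x in G]>>).

(* The first product is the setwise product of subgroups; it forces every
   member of s to lie in G. *)
Definition powerful_basis (gT : finGroupType) (G : {group gT}) (s : seq gT) :
    Prop :=
  \prod_(a <- s) <[a]> = G :> {set gT} /\ #|G| = (\prod_(a <- s) #[a])%N.

Definition type_2 (p : nat) (gT : finGroupType) (G : {group gT}) : Prop :=
  exists s : seq gT,
    powerful_basis G s /\ (forall a : gT, a \in s -> #[a] = (p ^ 2)%N).

(* By Cayley's theorem every group of order m is isomorphic to a subgroup of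
   the symmetric group of degree m; see powerful_groupsP below. *)
Definition powerful_groups (p n : nat) : {set {group 'S_(p ^ n)}} :=
  [set G : {group 'S_(p ^ n)} |
     [&& #|G| == (p ^ n)%N, powerful p G & `[< type_2 p G >]]].

Definition num_powerful (p n : nat) : nat :=
  #|equivalence_partition (fun G H : {group 'S_(p ^ n)} => G \isog H)
                          (powerful_groups p n)|.

Lemma perm_type_isog (T T' : finType) (G : {group {perm T}}) :
  #|T| = #|T'| -> exists H : {group {perm T'}}, G \isog H.
Proof.
move=> eqTT'; pose h (x : T) : T' := enum_val (cast_ord eqTT' (enum_rank x)).
pose g (y : T') : T := enum_val (cast_ord (esym eqTT') (enum_rank y)).
have hK : cancel h g by move=> x; rewrite /g /h enum_valK cast_ordK enum_rankK.
have gK : cancel g h by move=> x; rewrite /g /h enum_valK cast_ordKV enum_rankK.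
have c_inj (s : {perm T}) : injective (fun y => h (s (g y))).
  by move=> y z /(can_inj hK) /perm_inj /(can_inj gK).
pose c (s : {perm T}) : {perm T'} := perm (@c_inj s).
have cM : {in G &, {morph c : x y / x * y}}.
  by move=> x y _ _; apply/permP=> z; rewrite permM !permE /= hK.
have injc : 'injm (Morphism cM).
  apply/injmP=> x y _ _ /= /permP exy; apply/permP=> z.
  by have := exy (h z); rewrite !permE hK => /(can_inj hK).
by exists (Morphism cM @* G)%G; apply: (sub_isog (subxx _) injc).
Qed.

Lemma cayley (gT : finGroupType) (G : {group gT}) (m : nat) :
  #|G| = m -> exists H : {group 'S_m}, G \isog H.
Proof.
move=> oG; have iG := Cayley_isog [subg G].
have [|H iH] := @perm_type_isog _ 'I_m (Cayley_repr [subg G] @* [subg G])%G.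
  by rewrite card_ord -oG (card_isog (isog_subg G)) cardsT.
by exists H; apply: isog_trans (isog_subg G) (isog_trans iG iH).
Qed.

Lemma powerful_isog (p : nat) (gT rT : finGroupType)
    (G : {group gT}) (H : {group rT}) :
  G \isog H -> powerful p G -> powerful p H.
Proof.
move=> iGH; rewrite /powerful => /andP[pG sG].
rewrite /pgroup -(card_isog iGH) [pnat _ _]pG /=.
have /isogP[f injf <-] := iGH.
rewrite -morphimR // (subset_trans (morphimS f sG)) // morphim_gen; last first.
  by apply/subsetP=> _ /imsetP[x Gx ->]; rewrite groupX.
rewrite genS //; apply/subsetP=> _ /morphimP[_ _ /imsetP[x Gx ->] ->].
by apply/imsetP; exists (f x); rewrite ?mem_morphim ?morphX.
Qed.

Lemma prod_cycle_sub (gT : finGroupType) (s : seq gT) (a : gT) :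
  a \in s -> a \in \prod_(b <- s) <[b]>.
Proof.
have one1 (t : seq gT) : 1 \in \prod_(b <- t) <[b]>.
  elim: t => [|b t IH]; first by rewrite big_nil set11.
  by rewrite big_cons; apply/mulsgP; exists 1 1; rewrite ?mulg1 ?group1.
elim: s => // b s IH; rewrite inE big_cons => /orP[/eqP->|/IH sa].
  by apply/mulsgP; exists b 1; rewrite ?mulg1 ?cycle_id.
by apply/mulsgP; exists 1 a; rewrite ?mul1g ?group1.
Qed.

Lemma type_2_isog (p : nat) (gT rT : finGroupType)
    (G : {group gT}) (H : {group rT}) :
  G \isog H -> type_2 p G -> type_2 p H.
Proof.
move=> iGH [s [[prs ors] os]]; have cGH := card_isog iGH.
have /isogP[f injf fG] := iGH.
have sG a : a \in s -> a \in G.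
  by move=> sa; have := prod_cycle_sub sa; rewrite prs.
exists (map f s); split; first split; last first.
- by move=> _ /mapP[a sa ->]; rewrite order_injm ?os ?sG.
- rewrite -cGH ors big_map; apply: eq_big_seq => a sa.
  by rewrite order_injm ?sG.
rewrite big_map -fG; transitivity (f @* (\prod_(a <- s) <[a]>)); last by rewrite prs.
elim: s sG {prs ors os} => [|a s IH] sG; first by rewrite !big_nil morphim1.
rewrite !big_cons IH; last by move=> b sb; rewrite sG // inE sb orbT.
have Ga : a \in G by rewrite sG // mem_head.
by rewrite morphimMl ?cycle_subG // morphim_cycle.
Qed.

Lemma powerful_groupsP (p n : nat) (gT : finGroupType) (G : {group gT}) :
  #|G| = (p ^ n)%N -> powerful p G -> type_2 p G ->
  exists2 H : {group 'S_(p ^ n)}, H \in powerful_groups p n & G \isog H.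
Proof.
move=> oG pG tG; have [H iGH] := cayley oG; exists H => //.
rewrite inE -(card_isog iGH) oG eqxx (powerful_isog iGH pG) /=.
exact/asboolP/(type_2_isog iGH tG).
Qed.

(* Main.v *)
Require Import Defs.
From HB Require Import structures.
From mathcomp Require Import all_boot all_order all_algebra all_fingroup all_solvable.
From mathcomp Require Import boolp.
Import Order.TTheory GRing.Theory.

Set Implicit Arguments.
Unset Strict Implicit.
Unset Printing Implicit Defensive.

(* Write n = 2r.  In a powerful group G of type (2,...,2) with powerful basis
   a_1, ..., a_r the subgroup G^p is central and elementary abelian, so G is
   determined by the numbers c_ijk < p (j < i) such that
   [a_i, a_j] = \prod_k a_k^(p c_ijk); there are p^(r C(r, 2)) such arrays.
   Conversely every array c comes from the group on (Z/p^2)^r with law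
   x * y = x + y + p \sum_(j < i) x_i y_j c_ij, and the arrays which give groups
   isomorphic to G are told apart by the images of the r standard generators, so
   that there are at most |G|^r = p^(2 r^2) of them.  Hence the number of groups
   is p^(r^3 / 2 + O(r^2)). *)

(** * The p-power subgroup of a powerful p-group *)

Section PowerMap.

Local Open Scope group_scope.

Lemma dvdn_bin2 p : odd p -> p %| 'C(p, 2).
Proof. by move=> p_odd; rewrite bin2odd // dvdn_mulr. Qed.

(** In class 2, [(y * x) ^+ p] is [y ^+ p * x ^+ p] times [[~ x, y] ^+ 'C(p, 2)]. Oddness of [p]
    enters here: it makes [p] divide ['C(p, 2)], which kills the last factor. *)
Lemma central_expMg (p : nat) (gT : finGroupType) (x y : gT) :
    odd p -> commute x [~ x, y] -> commute y [~ x, y] -> [~ x, y] ^+ p = 1 ->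
  (y * x) ^+ p = y ^+ p * x ^+ p.
Proof.
move=> p_odd cx cy zp1; rewrite expMg_Rmul //.
by have /dvdnP[k ->] := dvdn_bin2 p_odd; rewrite mulnC expgM zp1 expg1n mulg1.
Qed.

End PowerMap.

Section Powerful.

Local Open Scope group_scope.

Variables (p : nat).
Hypothesis (p_odd : odd p).

(** For [x], [y] in [G], [[~ x ^+ p, y]] is [x ^- p * (x * [~ x, y]) ^+ p]. The commutator of [x]
    with [[~ x, y]] lies in [[~: 'Mho^1(G), G]], so it is central of exponent [p]; the expression
    collapses to [[~ x, y] ^+ p], which is 1 since [[~ x, y]] is in ['Mho^1(G)]. *)
Lemma Mho1_central_quotient (gT : finGroupType) (G : {group gT}) :
    p.-group G -> [~: G, G] \subset 'Mho^1(G) -> 'Mho^1('Mho^1(G)) = 1 ->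
    [~: 'Mho^1(G), G, G] = 1 ->
  'Mho^1(G) \subset 'C(G).
Proof.
move=> pG sG N1 NGG.
have pN : p.-group 'Mho^1(G) := pgroupS (Mho_sub _ _) pG.
have Np y : y \in 'Mho^1(G) -> y ^+ p = 1.
  move=> Ny; apply/set1gP; rewrite -N1 -[p]expn1.
  by apply: Mho_p_elt => //; apply: mem_p_elt Ny.
have cNG y z : y \in [~: 'Mho^1(G), G] -> z \in G -> commute z y.
  move=> Ry Gz; apply/commute_sym/commgP/eqP/set1gP; rewrite -NGG.
  exact: mem_commg.
have sNG : [~: 'Mho^1(G), G] \subset 'Mho^1(G).
  by rewrite commg_subl gFnorm.
rewrite (MhoE 1 pG) gen_subG; apply/subsetP => _ /imsetP[x Gx ->].
rewrite expn1; apply/centP => y Gy; apply/commgP.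
have Nc : [~ x, y] \in 'Mho^1(G) by rewrite (subsetP sG) ?mem_commg.
have Rc : [~ [~ x, y], x] \in [~: 'Mho^1(G), G] by rewrite mem_commg.
rewrite commgEl conjXg conjg_mulR (@central_expMg p _ [~ x, y] x) //.
- by rewrite (Np [~ x, y]) // mulg1 mulVg.
- by apply: cNG => //; apply: (subsetP (Mho_sub 1 G)).
- exact: cNG.
- by apply/Np/(subsetP sNG).
Qed.

(* It suffices to prove [N, G] \subset N^p [N, G, G] for N := 'Mho^1(G): modulo
   N^p this says [N, G] = [N, G, G], and G is nilpotent. *)
Lemma Mho1_powerfully_embedded (gT : finGroupType) (G : {group gT}) :
    p.-group G -> [~: G, G] \subset 'Mho^1(G) ->
  [~: 'Mho^1(G), G] \subset 'Mho^1('Mho^1(G)).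
Proof.
move=> pG sG; set N := 'Mho^1(G)%G; set P := 'Mho^1(N)%G.
have nNG : G \subset 'N(N) by exact: gFnorm.
have sNG : N \subset G by exact: Mho_sub.
have nPG : G \subset 'N(P) by rewrite !gFnorm_trans ?normG.
have nRG : G \subset 'N([~: N, G]) by rewrite normsR // normG.
have nRRG : G \subset 'N([~: N, G, G]) by rewrite normsR // normG.
have sRN : [~: N, G] \subset N by rewrite commg_subl.
pose M := (P <*> [~: N, G, G])%G.
have nMG : G \subset 'N(M) by rewrite normsY.
have sRM : [~: N, G] \subset M.
  rewrite -quotient_cents2 ?(subset_trans sNG) //.
  have NM : N / M = 'Mho^1(G / M) by exact: morphim_Mho.
  rewrite NM; apply: Mho1_central_quotient; rewrite ?quotient_pgroup //.
  - by rewrite -quotientR // -NM quotientS.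
  - rewrite -NM (_ : 'Mho^1(N / M) = P / M); last first.
      exact/esym/morphim_Mho/(subset_trans sNG).
    apply/trivgP; rewrite quotient_sub1 ?joing_subl //.
    exact: subset_trans (joing_subl _ _) (normG _).
  - rewrite -NM -!quotientR ?(subset_trans sNG) //.
    + apply/trivgP; rewrite quotient_sub1 ?joing_subr //.
      exact: subset_trans (joing_subr _ _) (normG _).
    + by rewrite (subset_trans sRN) ?(subset_trans sNG).
have nPR : [~: N, G] \subset 'N(P) by rewrite (subset_trans sRN) ?(subset_trans sNG).
rewrite -quotient_sub1 //; apply/negPn/negP => nt.
have nilG : nilpotent (G / P) by apply: pgroup_nil (quotient_pgroup _ pG).
have : [~: ([~: N, G] / P)%G, (G / P)%G] \proper ([~: N, G] / P)%G.
  apply: nil_comm_properl nilG _ _ _.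
  - by rewrite quotientS // (subset_trans sRN).
  - by apply: contraNneq nt => ->.
  - by rewrite subsetI subxx /= quotient_norms.
rewrite /= -quotientR // => /andP[_ /negP]; apply.
apply: subset_trans (quotientS P sRM) _.
rewrite /M /= /joing quotient_gen ?subUset.
  by rewrite gen_subG quotientU trivg_quotient subUset sub1G /=.
by rewrite normG /= (subset_trans (comm_subG (subset_trans sRN sNG) (subxx _))).
Qed.

(** The elements whose [p]-th power lies in the right-hand side form a subgroup, and it contains
    [S]. *)
Lemma Mho1_gen_morph (gT : finGroupType) (G : {group gT}) (S : {set gT}) :
    p.-group G -> {in G &, {morph (fun x => x ^+ p) : x y / x * y}} ->
    <<S>> = G ->
  'Mho^1(G) \subset <<[set s ^+ p | s in S]>>.
Proof.
move=> pG pM defG; set K := <<_>>.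
have gP : group_set [set x in G | x ^+ p \in K].
  apply/group_setP; split=> [|x y]; first by rewrite inE !group1 expg1n group1.
  by rewrite !inE => /andP[Gx Kx] /andP[Gy Ky]; rewrite groupM // pM // groupM.
have sGP : G \subset Group gP.
  rewrite -{1}defG gen_subG; apply/subsetP => s Ss.
  by rewrite inE -defG mem_gen //= mem_gen //; apply: imset_f.
rewrite (MhoE 1 pG) gen_subG; apply/subsetP => _ /imsetP[x Gx ->].
by have := subsetP sGP x Gx; rewrite inE expn1 => /andP[].
Qed.

Lemma powerful_Mho1_gen (gT : finGroupType) (G : {group gT}) (S : {set gT}) :
    p.-group G -> [~: G, G] \subset 'Mho^1(G) -> <<S>> = G ->
  'Mho^1(G) = <<[set s ^+ p | s in S]>>.
Proof.
move=> pG sG defG; set N := 'Mho^1(G)%G; set P := 'Mho^1(N)%G.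
have sNG : N \subset G by exact: Mho_sub.
have sSG : S \subset G by rewrite -defG subset_gen.
have nPG : G \subset 'N(P) by rewrite !gFnorm_trans ?normG.
have sRP := Mho1_powerfully_embedded pG sG.
have pN : p.-group N := pgroupS sNG pG.
set K := <<_>>.
have sKN : K \subset N.
  rewrite gen_subG; apply/subsetP => _ /imsetP[s Ss ->].
  by rewrite -[X in _ ^+ X]expn1 Mho_p_elt ?(mem_p_elt pG) ?(subsetP sSG).
have Gb : 'Mho^1(G / P) \subset K / P.
  have sSP : S \subset 'N(P) := subset_trans sSG nPG.
  suff : 'Mho^1(G / P) \subset <<[set s ^+ p | s in (S / P)]>>.
    move/subset_trans; apply; rewrite gen_subG.
    apply/subsetP => _ /imsetP[_ /morphimP[s Ns Ss ->] ->].
    rewrite -morphX // mem_quotient //.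
    by rewrite mem_gen //; apply: imset_f.
  apply: Mho1_gen_morph; rewrite ?quotient_pgroup //; last by rewrite -quotient_gen // defG.
  have cNG : N / P \subset 'C(G / P).
    by rewrite quotient_cents2 ?(subset_trans sNG).
  move=> x y Gx Gy; have Nc : [~ y, x] \in N / P.
    have : [~: G / P, G / P] \subset N / P by rewrite -quotientR ?quotientS.
    by move/subsetP; apply; rewrite mem_commg.
  apply: central_expMg => //.
  - by apply/commute_sym/(centP (subsetP cNG _ Nc)).
  - by apply/commute_sym/(centP (subsetP cNG _ Nc)).
  - case/morphimP: Nc => c Nc' Nc ->; rewrite -morphX //; apply: coset_id.
    by rewrite -[X in _ ^+ X]expn1 Mho_p_elt ?(mem_p_elt pN).
have defN : 'Phi(N) <*> K = N.
  apply/eqP; rewrite eqEsubset join_subG sKN Phi_sub /=.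
  have sPPhi : P \subset 'Phi(N) by rewrite (Phi_joing pN) joing_subr.
  apply: subset_trans (_ : P * K \subset _).
    by rewrite -quotientSK ?(subset_trans sNG) // [N / P]morphim_Mho.
  by rewrite mul_subG ?joing_subr // (subset_trans sPPhi) ?joing_subl.
by rewrite -[LHS](Phi_nongen defN) genGid.
Qed.

(* 'Mho^1(G) is generated by the powers s ^+ p and, being powerful as well, has
   its own 'Mho^1 generated by the s ^+ (p ^ 2), which are trivial. *)
Lemma powerful_Mho1_central (gT : finGroupType) (G : {group gT}) (S : {set gT}) :
    powerful p G -> <<S>> = G -> (forall s, s \in S -> s ^+ (p ^ 2) = 1) ->
  'Mho^1(G) \subset 'C(G) /\ {in 'Mho^1(G), forall x, x ^+ p = 1}.
Proof.
move=> /andP[pG sG] defG So; have sGM : [~: G, G] \subset 'Mho^1(G).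
  by rewrite (MhoE 1 pG) expn1.
have pN : p.-group 'Mho^1(G) := pgroupS (Mho_sub _ _) pG.
have sRP := Mho1_powerfully_embedded pG sGM.
have defN := powerful_Mho1_gen pG sGM defG.
have N1 : 'Mho^1('Mho^1(G)) = 1.
  rewrite (powerful_Mho1_gen pN _ (esym defN)).
    apply/trivgP; rewrite gen_subG; apply/subsetP => _ /imsetP[_ /imsetP[s Ss ->] ->].
    by rewrite -expgM So ?inE.
  by apply: subset_trans sRP; rewrite commgS ?Mho_sub.
split; first by apply/commG1P/trivgP; rewrite -N1.
move=> x Nx; apply/set1gP; rewrite -N1 -[X in _ ^+ X]expn1.
by rewrite Mho_p_elt ?(mem_p_elt pN).
Qed.

End Powerful.

Local Open Scope ring_scope.

(** * Finite abelian groups twisted by a bilinear cocycle *)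

(** Bilinear maps with values in both radicals: the two triple terms in the associativity law of
    [x + y + g x y] then vanish, and commutators are central. *)
Record cocycle (V : zmodType) := Cocycle {
  cocycle_fun :> V -> V -> V;
  cocycleDl : forall x y z, cocycle_fun (x + y) z = cocycle_fun x z + cocycle_fun y z;
  cocycleDr : forall x y z, cocycle_fun x (y + z) = cocycle_fun x y + cocycle_fun x z;
  cocycle_radl : forall x y z, cocycle_fun (cocycle_fun x y) z = 0;
  cocycle_radr : forall x y z, cocycle_fun x (cocycle_fun y z) = 0
}.

(** An alias of [V], so that the new group law does not clash with the additive structure of [V]. *)
Definition twist (V : finZmodType) (g : cocycle V) : Type := V.
HB.instance Definition _ V g := Finite.on (@twist V g).

Section Twist.

Variables (V : finZmodType) (g : cocycle V).
Local Notation twist := (twist g).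
Implicit Types x y z : V.

Lemma cocycle0l x : g 0 x = 0.
Proof. by apply: (addrI (g 0 x)); rewrite -cocycleDl !addr0. Qed.
Lemma cocycle0r x : g x 0 = 0.
Proof. by apply: (addrI (g x 0)); rewrite -cocycleDr !addr0. Qed.
Lemma cocycleNl x y : g (- x) y = - g x y.
Proof. by apply/eqP; rewrite -addr_eq0 -cocycleDl addNr cocycle0l. Qed.
Lemma cocycleNr x y : g x (- y) = - g x y.
Proof. by apply/eqP; rewrite -addr_eq0 -cocycleDr addNr cocycle0r. Qed.
Lemma cocycleMr x y n : g x (y *+ n) = g x y *+ n.
Proof. by elim: n => [|n IH]; rewrite ?cocycle0r // !mulrS cocycleDr IH. Qed.

Definition twist_mul (x y : twist) : twist := (x : V) + y + g x y.
(** The term [g x x] compensates for [g (- x) x = - g x x]. *)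
Definition twist_inv (x : twist) : twist := - (x : V) + g x x.

Fact twist_mulA : associative twist_mul.
Proof.
move=> x y z; rewrite /twist_mul !cocycleDl !cocycleDr cocycle_radl cocycle_radr.
rewrite !addr0 !addrA [_ + g x y + z]addrAC [_ + g y z + g x y]addrAC.
exact: addrAC.
Qed.
Fact twist_mul1 : left_id (0 : V) twist_mul.
Proof. by move=> x; rewrite /twist_mul cocycle0l add0r addr0. Qed.
Fact twist_mulV : left_inverse (0 : V) twist_inv twist_mul.
Proof.
move=> x; rewrite /twist_mul /twist_inv cocycleDl cocycle_radl cocycleNl addr0.
by rewrite addrAC addrK addNr.
Qed.

HB.instance Definition _ :=
  Finite_isGroup.Build twist twist_mulA twist_mul1 twist_mulV.

Lemma twistM (x y : twist) : (x * y)%g = (x : V) + y + g x y. Proof. by []. Qed.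
Lemma twist1 : (1%g : twist) = (0 : V). Proof. by []. Qed.

(** Each of the ['C(n, 2)] pairs of factors contributes one [g x x]. *)
Lemma twistX (x : twist) n : (x ^+ n)%g = ((x : V) *+ n + g x x *+ 'C(n, 2) : V).
Proof.
elim: n => [|n IH]; first by rewrite expg0 bin0n mulr0n addr0.
rewrite expgS IH twistM cocycleDr cocycleMr cocycleMr cocycle_radr mul0rn addr0.
by rewrite binS bin1 mulrS mulrnDr -!addrA [X in _ + (_ + X)]addrC.
Qed.

Lemma twistR (x y : twist) : [~ x, y]%g = (g x y - g y x : V).
Proof.
apply: (mulgI (y * x)%g); rewrite -commgC; rewrite !twistM.
rewrite !(cocycleDl, cocycleDr, cocycleNr, cocycle_radl, cocycle_radr).
rewrite !(subr0, addr0).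
by rewrite [in RHS](addrC (y : V)) -[in RHS]addrA [g y x + _]addrC subrK.
Qed.

End Twist.

(** * The group attached to an array of structure constants *)

Definition lower_pair (r : nat) : predArgType :=
  {ij : 'I_r * 'I_r | (ij.2 < ij.1)%N}.
HB.instance Definition _ r := Finite.on (lower_pair r).

Definition structure_consts (p r : nat) : predArgType :=
  {ffun lower_pair r * 'I_r -> 'I_p}.
HB.instance Definition _ p r := Finite.on (structure_consts p r).

Lemma card_lower_pair r : #|{: lower_pair r}| = 'C(r, 2).
Proof.
rewrite card_sig -bin2_sum big_mkord -sum1_card.
rewrite (eq_bigl (fun ij : 'I_r * 'I_r => true && (ij.2 < ij.1)%N)) //.
rewrite -(pair_big_dep xpredT (fun i j : 'I_r => (j < i)%N) (fun _ _ => 1%N)) /=.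
apply: eq_bigr => i _; rewrite -(big_ord_widen _ (fun=> 1%N)) ?sum1_card ?card_ord //.
exact/ltnW/ltn_ord.
Qed.

Lemma card_structure_consts p r : #|{: structure_consts p r}| = (p ^ ('C(r, 2) * r))%N.
Proof. by rewrite card_ffun card_prod !card_ord card_lower_pair. Qed.

Lemma mem_prod_cycle (gT : finGroupType) (I : Type) (s : seq I) (a : I -> gT)
    (n : I -> nat) :
  (\prod_(i <- s) a i ^+ n i \in \prod_(i <- s) <[a i]>)%g.
Proof.
elim: s => [|i s IH]; first by rewrite !big_nil set11.
by rewrite !big_cons mem_mulg ?mem_cycle.
Qed.

(** The exponent is a function of the index and not of its position, hence the condition
    [uniq s]. *)
Lemma prod_cycleP (gT : finGroupType) (I : eqType) (s : seq I) (a : I -> gT) (x : gT) :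
    uniq s -> (x \in \prod_(i <- s) <[a i]>)%g ->
  exists n : I -> nat, x = (\prod_(i <- s) a i ^+ n i)%g.
Proof.
elim: s x => [|i s IH] x.
  by rewrite big_nil => _ /set1gP->; exists (fun=> 0%N); rewrite big_nil.
rewrite big_cons => /andP[s'i uniq_s] /mulsgP[_ y /cycleP[m ->] /(IH _ uniq_s)[n ->] ->].
exists (fun j => if j == i then m else n j); rewrite big_cons eqxx; congr (_ * _)%g.
by apply: eq_big_seq => j sj; rewrite ifN //; apply: contraNneq s'i => <-.
Qed.

Section StructureGroup.

Variables (p : nat) (p_pr : prime p) (r : nat).
Notation Zq := 'Z_(p ^ 2).
Notation V := 'rV[Zq]_r.
Implicit Types (x y z : V) (i j k : 'I_r).

Let q_gt1 : (1 < p ^ 2)%N.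
Proof. by rewrite -(exp1n 2) ltn_sqr prime_gt1. Qed.

Lemma card_Zq_row : #|{: V}| = (p ^ (r.*2))%N.
Proof. by rewrite card_mx card_ord Zp_cast // mul1n -expnM mul2n. Qed.

Section Form.

Variable c : structure_consts p r.

(* The row is 0 unless j < i. *)
Definition const_row i j : V :=
  \row_k (if insub (i, j) is Some u then (c (u, k))%:R else 0).

Definition cform x y : V :=
  \sum_(i < r) \sum_(j < r | (j < i)%N) (x 0 i * y 0 j) *: const_row i j.

Lemma cformDl x y z : cform (x + y) z = cform x z + cform y z.
Proof.
rewrite -big_split; apply: eq_bigr => i _; rewrite -big_split.
by apply: eq_bigr => j _ /=; rewrite mxE mulrDl scalerDl.
Qed.

Lemma cformDr x y z : cform x (y + z) = cform x y + cform x z.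
Proof.
rewrite -big_split; apply: eq_bigr => i _; rewrite -big_split.
by apply: eq_bigr => j _ /=; rewrite mxE mulrDr scalerDl.
Qed.

Lemma cformZl a x y : cform (a *: x) y = a *: cform x y.
Proof.
rewrite scaler_sumr; apply: eq_bigr => i _; rewrite scaler_sumr.
by apply: eq_bigr => j _; rewrite mxE -mulrA scalerA.
Qed.

Lemma cformZr a x y : cform x (a *: y) = a *: cform x y.
Proof.
rewrite scaler_sumr; apply: eq_bigr => i _; rewrite scaler_sumr.
by apply: eq_bigr => j _; rewrite mxE mulrCA scalerA.
Qed.

Lemma cform_deltal i y :
  cform (delta_mx 0 i) y = \sum_(j < r | (j < i)%N) y 0 j *: const_row i j.
Proof.
rewrite /cform (bigD1 i) //= [X in _ + X]big1 ?addr0 => [|i' ne_i'i].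
  by apply: eq_bigr => j _; rewrite mxE !eqxx mul1r.
by apply: big1 => j _; rewrite mxE (negPf ne_i'i) andbF mul0r scale0r.
Qed.

Lemma cform_delta i j : (j < i)%N -> cform (delta_mx 0 i) (delta_mx 0 j) = const_row i j.
Proof.
move=> lt_ji; rewrite cform_deltal (bigD1 j) //= [X in _ + X]big1 ?addr0.
  by rewrite mxE !eqxx scale1r.
by move=> j' /andP[_ ne]; rewrite mxE (negPf ne) andbF scale0r.
Qed.

Lemma cform_delta0 i y : (forall j, (j < i)%N -> y 0 j = 0) -> cform (delta_mx 0 i) y = 0.
Proof. by move=> y0; rewrite cform_deltal big1 // => j /y0->; rewrite scale0r. Qed.

Lemma sqr_p0 : p%:R * p%:R = 0 :> Zq.
Proof. by rewrite -natrM mulnn pchar_Zp. Qed.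

(** The factor [p] puts all values into the radicals, because [p * p = 0] in [Zq]. *)
Definition pform x y : V := p%:R *: cform x y.

Fact pformDl x y z : pform (x + y) z = pform x z + pform y z.
Proof. by rewrite /pform cformDl scalerDr. Qed.
Fact pformDr x y z : pform x (y + z) = pform x y + pform x z.
Proof. by rewrite /pform cformDr scalerDr. Qed.
Fact pform_radl x y z : pform (pform x y) z = 0.
Proof. by rewrite /pform cformZl scalerA sqr_p0 scale0r. Qed.
Fact pform_radr x y z : pform x (pform y z) = 0.
Proof. by rewrite /pform cformZr scalerA sqr_p0 scale0r. Qed.

Definition pcocycle := Cocycle pformDl pformDr pform_radl pform_radr.

Definition sgroup := twist pcocycle.
HB.instance Definition _ := FinGroup.on sgroup.

Definition sgen i : sgroup := delta_mx 0 i.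

(** The form is strictly triangular, so it vanishes on [(e_i, e_i)] and powers of a generator are
    the additive multiples. *)
Lemma sgenX i n : (sgen i ^+ n)%g = (delta_mx 0 i *+ n : V).
Proof.
rewrite twistX [pcocycle _ _](_ : _ = 0) ?mul0rn ?addr0 //.
rewrite /= /pform cform_delta0 ?scaler0 // => j ltji.
by rewrite mxE (ltn_eqF ltji : (j == i) = false) andbF.
Qed.

(* The form pairs e_i with e_j only for j < i, so it never contributes to a
   product of generators taken in increasing order. *)
Lemma sgen_prod (s : seq 'I_r) x :
    pairwise (fun i j : 'I_r => i < j)%N s ->
  (\prod_(i <- s) sgen i ^+ (x ord0 i))%g =
    (\row_k (if k \in s then x 0 k else 0) : V).
Proof.
elim: s => [_|i s IH].
  by rewrite big_nil twist1; apply/rowP => k; rewrite !mxE.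
rewrite pairwise_cons => /andP[lt_is /IH{}IH]; rewrite big_cons IH sgenX twistM.
rewrite -scaler_nat natr_Zp [pcocycle _ _](_ : _ = 0) ?addr0.
  apply/rowP => k; rewrite !mxE inE.
  have [->|] := eqVneq k i; last by rewrite mulr0 add0r.
  rewrite mulr1 ifN ?addr0 //.
  by apply/negP => /(allP lt_is); rewrite ltnn.
rewrite /= /pform cformZl cform_delta0 ?scaler0 // => j lt_ji.
rewrite mxE ifN //; apply/negP => /(allP lt_is).
by rewrite ltnNge ltnW.
Qed.

Lemma pairwise_enum_ord : pairwise (fun i j : 'I_r => i < j)%N (enum 'I_r).
Proof.
have := iota_ltn_sorted 0 r; rewrite sorted_pairwise; last exact: ltn_trans.
by rewrite -val_enum_ord pairwise_map.
Qed.

Lemma sgroup_expand (x : sgroup) :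
  (\prod_(i <- enum 'I_r) sgen i ^+ ((x : V) 0 i))%g = x.
Proof.
rewrite sgen_prod ?pairwise_enum_ord //.
by apply/rowP => k; rewrite mxE mem_enum.
Qed.

Lemma card_sgroup : #|[set: sgroup]| = (p ^ (r.*2))%N.
Proof. by rewrite cardsT -card_Zq_row. Qed.

Lemma order_sgen i : #[sgen i]%g = (p ^ 2)%N.
Proof.
apply/eqP; rewrite eqn_dvd order_dvdn sgenX -scaler_nat pchar_Zp // scale0r eqxx /=.
have := expg_order (sgen i); rewrite sgenX => /rowP/(_ i).
rewrite -scaler_nat !mxE !eqxx mulr1 => /(congr1 val) /=.
by rewrite val_Zp_nat //= => /eqP.
Qed.

(** Every commutator is itself a [p]-th power: it is [p] times the antisymmetrized [cform], and the
    correction term of the power [z ^+ p] is divisible by [p * p]. *)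
Lemma sgroup_powerful : odd p -> powerful p [set: sgroup]%G.
Proof.
move=> p_odd; rewrite /powerful /pgroup card_sgroup pnatX pnat_id //=.
rewrite gen_subG; apply/subsetP => _ /imset2P[x y _ _ ->].
pose z : sgroup := (cform (x : V) (y : V) - cform (y : V) (x : V)).
apply/mem_gen/imsetP; exists z; rewrite ?inE // twistR twistX.
have -> : pcocycle z z *+ 'C(p, 2) = 0.
  have /dvdnP[k ->] := dvdn_bin2 p_odd; rewrite mulnC mulrnA -[_ *+ p]scaler_nat /=.
  by rewrite /pform scalerA sqr_p0 scale0r mul0rn.
by rewrite addr0 -scaler_nat scalerBr.
Qed.

Lemma sgroup_type2 : type_2 p [set: sgroup]%G.
Proof.
exists [seq sgen i | i <- enum 'I_r]; split; last first.
  by move=> _ /mapP[i _ ->]; exact: order_sgen.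
split.
  apply/eqP; rewrite eqEsubset subsetT; apply/subsetP => x _.
  rewrite big_map -(sgroup_expand x).
  exact: (mem_prod_cycle _ sgen (fun i => (x : V) 0 i)).
rewrite card_sgroup big_map (eq_bigr (fun=> p ^ 2)%N) => [|i _]; last exact: order_sgen.
by rewrite big_enum prod_nat_const card_ord -expnM mul2n.
Qed.

End Form.

End StructureGroup.

(** * Recovering the structure constants from a powerful basis *)

Section CentralProducts.

Local Open Scope group_scope.

Variables (gT : finGroupType) (G : {group gT}).

Lemma prodM_central (I : Type) (s : seq I) (P : pred I) (g h : I -> gT) :
    (forall i, g i \in G) -> (forall i, h i \in 'C(G)) ->
  \prod_(i <- s | P i) (g i * h i) =
    \prod_(i <- s | P i) g i * \prod_(i <- s | P i) h i.
Proof.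
move=> Gg Ch; elim: s => [|i s IH]; first by rewrite !big_nil mulg1.
rewrite !big_cons; case: (P i) => //; rewrite IH -!mulgA; congr (_ * _).
rewrite !mulgA; congr (_ * _); apply: (centP (Ch i)).
exact: group_prod.
Qed.

Lemma commg_prodl (I : Type) (s : seq I) (g : I -> gT) (y : gT) :
    (forall i, g i \in G) -> (forall i, [~ g i, y] \in 'C(G)) ->
  [~ \prod_(i <- s) g i, y] = \prod_(i <- s) [~ g i, y].
Proof.
move=> Gg Cg; elim: s => [|i s IH]; first by rewrite !big_nil comm1g.
rewrite !big_cons commMgJ IH; congr (_ * _); apply/conjg_fixP/commgP.
exact/(centP (Cg i))/group_prod.
Qed.

(** Collection in class 2: moving [a j ^+ Y j] to the left past [a i ^+ X i], for [j < i], costs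
    [[~ a i, a j] ^+ (X i * Y j)]. This is the twisted group law in multiplicative form. *)
Lemma prod_expM_central (r : nat) (s : seq 'I_r) (a : 'I_r -> gT) (X Y : 'I_r -> nat) :
    pairwise (fun i j : 'I_r => i < j)%N s -> (forall i, a i \in G) ->
    (forall i j, [~ a i, a j] \in 'C(G)) ->
  \prod_(i <- s) a i ^+ X i * \prod_(i <- s) a i ^+ Y i =
    \prod_(i <- s) a i ^+ (X i + Y i) *
    \prod_(i <- s) \prod_(j <- s | (j < i)%N) [~ a i, a j] ^+ (X i * Y j).
Proof.
move=> + Ga Ca.
have cc i j k : commute (a k) [~ a i, a j].
  by apply/commute_sym; exact: (centP (Ca i j)).
elim: s => [_|k s IH]; first by rewrite !big_nil mulg1.
rewrite pairwise_cons => /andP[lt_ks /IH{}IH].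
have CX i : [~ a i ^+ X i, a k ^+ Y k] \in 'C(G) by rewrite commXXg ?groupX.
set A := \prod_(i <- s) a i ^+ X i in IH *.
have GX i : a i ^+ X i \in G by rewrite groupX.
have GA : A \in G by apply: group_prod.
have defR := commg_prodl s GX CX; rewrite -/A in defR.
have CA : [~ A, a k ^+ Y k] \in 'C(G) by rewrite defR group_prod.
set K := \prod_(i <- s) \prod_(j <- s | _) _ in IH.
(* As [k] is the least index, the row [i = k] is empty, and the column [j = k] collects into the
   single commutator [[~ A, a k ^+ Y k]]. *)
have -> : \prod_(i <- k :: s) \prod_(j <- k :: s | (j < i)%N) [~ a i, a j] ^+ (X i * Y j) =
    [~ A, a k ^+ Y k] * K.
  rewrite [LHS]big_cons [X in X * _]big_cons ltnn big_seq_cond big1 ?mul1g; last first.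
    by move=> j /andP[/(allP lt_ks) lt_kj]; rewrite ltnNge ltnW.
  rewrite defR -prodM_central; first last.
  - by move=> i; apply: group_prod => j _; rewrite groupX.
  - by move=> i; rewrite groupR ?groupX.
  by apply: eq_big_seq => i si; rewrite big_cons (allP lt_ks) // commXXg.
rewrite !big_cons -/A expgD; set B := \prod_(i <- s) a i ^+ Y i in IH *.
set AB := \prod_(i <- s) _ in IH *; set R := [~ A, _] in CA *.
have GAB : AB \in G by apply: group_prod => i _; rewrite groupX.
have eC := commgC A (a k ^+ Y k); rewrite -/R in eC; clearbody R.
rewrite -!mulgA [A * _]mulgA eC -!mulgA; do 2!congr (_ * _).
by rewrite [A * _]mulgA -(centP CA A GA) -mulgA IH mulgA (centP CA AB GAB) -mulgA.
Qed.

End CentralProducts.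

Lemma expg_Zp_nat (q : nat) (gT : finGroupType) (a : gT) (n : nat) :
  (1 < q)%N -> (a ^+ q = 1 -> a ^+ (n%:R : 'Z_q)%R = a ^+ n)%g.
Proof. by move=> q_gt1 aq1; rewrite val_Zp_nat // expg_mod. Qed.

(** * A group with a powerful basis of elements of order [p ^ 2] is a structure group *)

Section Classification.

Variables (p : nat) (p_pr : prime p) (p_odd : odd p) (r : nat).
Notation Zq := 'Z_(p ^ 2).
Notation V := 'rV[Zq]_r.
Variables (gT : finGroupType) (G : {group gT}) (a : 'I_r -> gT).
Hypotheses (oG : #|G| = (p ^ (r.*2))%N) (pG : powerful p G).
Hypothesis (defG : (\prod_(i <- enum 'I_r) <[a i]>)%g = G).
Hypothesis (oa : forall i, #[a i]%g = (p ^ 2)%N).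

Let q_gt1 : (1 < p ^ 2)%N.
Proof. by rewrite -(exp1n 2) ltn_sqr prime_gt1. Qed.

Let aq1 i : (a i ^+ (p ^ 2) = 1)%g.
Proof. by rewrite -(oa i) expg_order. Qed.

Lemma basis_mem i : a i \in G.
Proof.
rewrite -[gval G]defG -(big_map a xpredT (fun x => <[x]>%g)).
by apply: prod_cycle_sub; rewrite map_f ?mem_enum.
Qed.

Lemma basis_prodP x : x \in G ->
  exists n : 'I_r -> nat, x = (\prod_(i <- enum 'I_r) a i ^+ n i)%g.
Proof. by rewrite -[gval G]defG; apply: prod_cycleP; exact: enum_uniq. Qed.

Lemma basis_gen : <<[set a i | i : 'I_r]>>%g = G.
Proof.
apply/eqP; rewrite eqEsubset gen_subG; apply/andP; split.
  by apply/subsetP => _ /imsetP[i _ ->]; exact: basis_mem.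
apply/subsetP => x /basis_prodP[n ->]; apply: group_prod => i _.
by rewrite groupX // mem_gen //; apply/imsetP; exists i.
Qed.

Lemma basis_Mho1 :
  'Mho^1(G)%g \subset 'C(G)%g /\ {in 'Mho^1(G)%g, forall x, x ^+ p = 1}%g.
Proof.
apply: (powerful_Mho1_central p_odd pG basis_gen) => _ /imsetP[i _ ->].
exact: aq1.
Qed.

Lemma commg_Mho1 x y : x \in G -> y \in G -> [~ x, y]%g \in 'Mho^1(G)%g.
Proof.
have /andP[pgG sG] := pG.
by move=> Gx Gy; rewrite (MhoE 1 pgG) expn1 (subsetP sG) ?mem_commg.
Qed.

Lemma commg_basis_central i j : [~ a i, a j]%g \in 'C(G)%g.
Proof. by rewrite (subsetP basis_Mho1.1) ?commg_Mho1 ?basis_mem. Qed.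

Lemma basisXp_central i n : (a i ^+ (p * n))%g \in 'C(G)%g.
Proof.
have /andP[pgG _] := pG.
rewrite expgM groupX // (subsetP basis_Mho1.1) //.
by rewrite -[X in (_ ^+ X)%g]expn1 Mho_p_elt ?basis_mem // (mem_p_elt pgG) ?basis_mem.
Qed.

(** Commutators in [G] are central of exponent [p], so [p]-th powers can be taken factor by
    factor. *)
Lemma basis_prodX (n : 'I_r -> nat) :
  ((\prod_(i <- enum 'I_r) a i ^+ n i) ^+ p)%g =
    (\prod_(i <- enum 'I_r) a i ^+ (p * n i))%g.
Proof.
elim: (enum 'I_r) => [|i s IH]; first by rewrite !big_nil expg1n.
rewrite !big_cons -IH mulnC expgM.
set x := (a i ^+ n i)%g; set y := bigop _ _ _.
have Gx : x \in G by rewrite groupX ?basis_mem.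
have Gy : y \in G by apply: group_prod => j _; rewrite groupX ?basis_mem.
have Mc := commg_Mho1 Gy Gx; have [sMC Mp] := basis_Mho1.
apply: central_expMg => //; last exact: Mp.
  by apply/commute_sym; exact: (centP (subsetP sMC _ Mc)).
by apply/commute_sym; exact: (centP (subsetP sMC _ Mc)).
Qed.

Definition basis_word (x : V) : gT := (\prod_(i <- enum 'I_r) a i ^+ (x ord0 i))%g.
(** This is the [basis_word] of [p%:R *: w]. Unlike [basis_word], it is additive in its argument. *)
Definition central_word (w : V) : gT :=
  (\prod_(i <- enum 'I_r) a i ^+ (p * w ord0 i))%g.

Lemma basis_word_mem x : basis_word x \in G.
Proof. by apply: group_prod => i _; rewrite groupX ?basis_mem. Qed.

(** The sum on the left is reduced modulo [p ^ 2], which [a i] does not notice. *)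
Lemma expg_basisD i (u v : Zq) : (a i ^+ (u + v)%R = a i ^+ (u + v)%N)%g.
Proof. by rewrite -{1}(natr_Zp u) -{1}(natr_Zp v) -natrD expg_Zp_nat. Qed.

Lemma expg_basisM i n (u : Zq) : (a i ^+ (n%:R * u)%R = a i ^+ (n * u)%N)%g.
Proof. by rewrite -{1}(natr_Zp u) -natrM expg_Zp_nat. Qed.

Lemma central_wordD u v : central_word (u + v) = (central_word u * central_word v)%g.
Proof.
rewrite /central_word -(@prodM_central _ G); first last.
- by move=> i; exact: basisXp_central.
- by move=> i; rewrite groupX ?basis_mem.
apply: eq_bigr => i _; rewrite mxE -expgD -mulnDr [in LHS]mulnC [in LHS]expgM expg_basisD.
by rewrite -expgM mulnC.
Qed.

Lemma central_word0 : central_word 0 = 1%g.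
Proof. by apply: big1 => i _; rewrite mxE muln0. Qed.

Lemma central_wordMn w n : central_word (w *+ n) = (central_word w ^+ n)%g.
Proof.
by elim: n => [|n IH]; rewrite ?central_word0 // mulrS central_wordD IH expgS.
Qed.

Lemma basis_wordDp x w :
  basis_word (x + p%:R *: w) = (basis_word x * central_word w)%g.
Proof.
rewrite /basis_word /central_word -(@prodM_central _ G); first last.
- by move=> i; exact: basisXp_central.
- by move=> i; rewrite groupX ?basis_mem.
by apply: eq_bigr => i _; rewrite !mxE expg_basisD expgD expg_basisM.
Qed.

Lemma central_word_nat (n : 'I_r -> nat) :
  central_word (\row_i (n i)%:R) = (\prod_(i <- enum 'I_r) a i ^+ (p * n i))%g.
Proof.
apply: eq_bigr => i _; rewrite mxE [in LHS]mulnC expgM expg_Zp_nat //.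
by rewrite -expgM mulnC.
Qed.

(** By additivity the central words form a subgroup, and by [basis_prodX] it contains every [p]-th
    power. *)
Lemma Mho1_central_word x : x \in 'Mho^1(G)%g -> exists w, x = central_word w.
Proof.
have /andP[pgG _] := pG.
have gP : group_set [set central_word w | w : V].
  apply/group_setP; split=> [|_ _ /imsetP[u _ ->] /imsetP[v _ ->]].
    by apply/imsetP; exists 0; rewrite ?central_word0.
  by apply/imsetP; exists (u + v); rewrite ?central_wordD.
suff /subsetP sMP : 'Mho^1(G)%g \subset Group gP by case/sMP/imsetP => w _ ->; exists w.
rewrite (MhoE 1 pgG) gen_subG; apply/subsetP => _ /imsetP[y Gy ->].
have [n ->] := basis_prodP Gy; rewrite expn1 basis_prodX -central_word_nat.
exact: imset_f.
Qed.

Lemma exists_consts : exists c : structure_consts p r,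
  forall i j : 'I_r, (j < i)%N -> central_word (const_row c i j) = [~ a i, a j]%g.
Proof.
have /fin_all_exists[w wP] (ij : 'I_r * 'I_r) :
    exists w, [~ a ij.1, a ij.2]%g = central_word w.
  by apply: Mho1_central_word; rewrite commg_Mho1 ?basis_mem.
(* Reducing the coordinates modulo [p] leaves the central word unchanged, because they occur as
   exponents of [a k ^+ p]. *)
pose c : structure_consts p r :=
  [ffun uk => Ordinal (ltn_pmod (w (val uk.1) ord0 uk.2) (prime_gt0 p_pr))].
exists c => i j lt_ji; rewrite (wP (i, j)).
have -> : const_row c i j = \row_k (w (i, j) ord0 k %% p)%:R.
  by apply/rowP => k; rewrite !mxE insubT ffunE.
rewrite central_word_nat; apply: eq_bigr => k _.
by rewrite !expgM expg_mod // -expgM mulnn.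
Qed.

(** The isomorphism is [basis_word]: the twisted law matches the collection formula, the powerful
    basis gives surjectivity, and equality of orders gives injectivity. *)
Lemma sgroup_isog : exists c : structure_consts p r, [set: sgroup p_pr c]%G \isog G.
Proof.
have [c cP] := exists_consts; exists c.
(* [central_word] turns the sum defining [cform] into the product of commutators of the collection
   formula. *)
have cwE (x y : V) : central_word (cform c x y) =
    (\prod_(i <- enum 'I_r) \prod_(j <- enum 'I_r | (j < i)%N)
       [~ a i, a j] ^+ (x ord0 i * y ord0 j)%N)%g.
  rewrite /cform -[X in central_word X]/(\sum_(i in 'I_r) _) -big_enum.
  rewrite (big_morph _ central_wordD central_word0); apply: eq_bigr => i _.
  rewrite -[X in central_word X]/(\sum_(j in 'I_r | _) _) -big_enum_cond.
  rewrite (big_morph _ central_wordD central_word0); apply: eq_bigr => j lt_ji.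
  rewrite -cP // -central_wordMn -scaler_nat natrM.
  by rewrite !natr_Zp.
pose f (x : sgroup p_pr c) : gT := basis_word x.
have fM : {in [set: sgroup p_pr c] &, {morph f : x y / (x * y)%g}}.
  move=> x y _ _; rewrite /f twistM /= basis_wordDp cwE /basis_word.
  rewrite (@prod_expM_central _ G) ?pairwise_enum_ord //; first last.
  - exact: commg_basis_central.
  - exact: basis_mem.
  by congr (_ * _)%g; apply: eq_bigr => i _; rewrite mxE expg_basisD.
have imf : (Morphism fM @* [set: sgroup p_pr c])%g = G.
  apply/eqP; rewrite eqEsubset; apply/andP; split.
    by apply/subsetP => _ /morphimP[x _ _ ->]; exact: basis_word_mem.
  apply/subsetP => x /basis_prodP[n ->].
  apply/morphimP; exists (\row_i (n i)%:R : V); rewrite ?inE //=.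
  by apply: eq_bigr => i _; rewrite mxE expg_Zp_nat.
apply/isogP; exists (Morphism fM) => //.
by rewrite -card_im_injm imf oG card_sgroup.
Qed.

End Classification.

(** * Counting isomorphism classes *)

Section Counting.

Variables (p : nat) (p_pr : prime p) (p_odd : odd p) (r : nat).
Notation Zq := 'Z_(p ^ 2).
Notation V := 'rV[Zq]_r.
Notation sgroup := (@sgroup p p_pr r).

Lemma type2_sgroup_isog (gT : finGroupType) (G : {group gT}) :
    #|G| = (p ^ (r.*2))%N -> powerful p G -> type_2 p G ->
  exists c : structure_consts p r, [set: sgroup c]%G \isog G.
Proof.
move=> oG pG [s [[defG os] oa]].
(* The length of the basis is forced by [(p ^ 2) ^ size s = p ^ r.*2]. *)
have size_s : size s = r.
  apply: double_inj; apply/eqP; rewrite -(eqn_exp2l _ _ (prime_gt1 p_pr)).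
  rewrite -oG os big_seq (eq_bigr (fun=> p ^ 2)%N) => [|a /oa //].
  by rewrite -big_seq big_const_seq count_predT iter_muln_1 -expnM mul2n.
have defs : s = map (tnth (Tuple (introT eqP size_s))) (enum 'I_r).
  by rewrite map_tnth_enum.
apply: (sgroup_isog p_pr p_odd (a := tnth (Tuple (introT eqP size_s)))) => //.
  by rewrite -(big_map _ xpredT (fun a => <[a]>%g)) -defs.
by move=> i; apply: oa; exact: mem_tnth.
Qed.

(** Both groups live on [V], and a row is the same word in the generators of either, so [f] and [f']
    agree on [V]. Injectivity of [f] then identifies the two products, from which the constants are
    read off at pairs of unit rows. *)
Lemma sgroup_morph_inj (gT : finGroupType) (c c' : structure_consts p r)
    (f : {morphism [set: sgroup c] >-> gT}) (f' : {morphism [set: sgroup c'] >-> gT}) :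
  ('injm f)%g -> (forall i, f (sgen p_pr c i) = f' (sgen p_pr c' i)) -> c = c'.
Proof.
move=> injf eqff'; have eqf (x : V) : f (x : sgroup c) = f' (x : sgroup c').
  rewrite -[in LHS](@sgroup_expand p p_pr r c x) -[in RHS](@sgroup_expand p p_pr r c' x).
  rewrite (morph_prod f) => [|i _]; last exact: in_setT.
  rewrite (morph_prod f') => [|i _]; last exact: in_setT.
  apply: eq_bigr => i _.
  rewrite (morphX f) ?in_setT // (morphX f') ?in_setT //.
  by congr (_ ^+ _)%g; exact: eqff'.
have eqM (x y : V) : ((x : sgroup c) * y)%g = ((x : sgroup c') * y)%g :> V.
  apply: (injmP injf _ _ (in_setT _) (in_setT _)); apply: etrans (esym (eqf _)).
  rewrite (morphM f) ?in_setT // (morphM f') ?in_setT //.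
  by congr (_ * _)%g; exact: eqf.
apply/ffunP => -[[[i j] /= lt_ji] k].
have := eqM (delta_mx 0 i) (delta_mx 0 j).
rewrite !twistM => /addrI; rewrite /= /pform !cform_delta //.
move/rowP/(_ k); rewrite !mxE !insubT -!natrM => /(congr1 val) /=.
(* Constants below [p] survive multiplication by [p] modulo [p ^ 2] without wrapping around. *)
have lt_pc (d : structure_consts p r) u : (p * d u < p ^ 2)%N.
  by rewrite -mulnn ltn_pmul2l ?prime_gt0.
have q_gt1 : (1 < p ^ 2)%N by rewrite -(exp1n 2) ltn_sqr prime_gt1.
rewrite !val_Zp_nat // !modn_small // => /eqP.
rewrite eqn_pmul2l ?prime_gt0 // => /eqP eq_c; exact/val_inj.
Qed.

(** Choose an isomorphism for each such [c] and record the images of the [r] generators; by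
    [sgroup_morph_inj] this tuple determines [c]. *)
Lemma card_isog_sgroup (c0 : structure_consts p r) :
  (#|[set c | [set: sgroup c]%G \isog [set: sgroup c0]%G]| <= p ^ (r.*2 * r))%N.
Proof.
set A := [set c | _].
have /fin_all_exists[t tP] (c : structure_consts p r) :
    exists t : {ffun 'I_r -> sgroup c0}, c \in A ->
    exists2 f : {morphism [set: sgroup c] >-> sgroup c0},
      ('injm f)%g & forall i, f (sgen p_pr c i) = t i.
  (* Outside [A] the tuple is an arbitrary default. *)
  rewrite inE; case isoc: (_ \isog _); last by exists [ffun=> 1%g].
  have /isogP[f injf _] := isoc; exists [ffun i => f (sgen p_pr c i)] => _.
  by exists f => // i; rewrite ffunE.
have tI : {in A &, injective t}.
  move=> c c' Ac Ac' eqt; have [f injf ft] := tP c Ac; have [f' _ ft'] := tP c' Ac'.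
  by apply: (sgroup_morph_inj injf (f' := f')) => i; rewrite ft ft' eqt.
rewrite -(card_in_imset tI) (leq_trans (max_card _)) //.
by rewrite card_ffun card_ord -cardsT card_sgroup -expnM.
Qed.

Let n := r.*2.
Let D := powerful_groups p n.
Let isogS (G H : {group 'S_(p ^ n)}) := G \isog H.
Let Pn := equivalence_partition isogS D.

Let isogS_equiv : {in D & &, equivalence_rel isogS}.
Proof.
move=> G H K _ _ _; split; first exact: isog_refl.
by move=> iGH; apply: isog_transl.
Qed.

Let partPn : partition Pn D := equivalence_partitionP isogS_equiv.

Lemma sgroup_representative (c : structure_consts p r) :
  exists2 H : {group 'S_(p ^ n)}, H \in D & [set: sgroup c]%G \isog H.
Proof.
have oG := card_sgroup p_pr c.
exact: powerful_groupsP oG (sgroup_powerful p_pr c p_odd) (sgroup_type2 p_pr c).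
Qed.

(** The map [B] from arrays to isomorphism classes is onto, and each of its fibres has at most
    [p ^ (n * r)] elements. *)
Lemma num_powerful_bounds :
  (num_powerful p n <= p ^ ('C(r, 2) * r) <= num_powerful p n * p ^ (n * r))%N.
Proof.
have [h hD hP] := fin_all_exists2 sgroup_representative.
have /and3P[/eqP coverP trivP ntP] := partPn.
pose B c := pblock Pn (h c).
have BP c : B c \in Pn by rewrite pblock_mem // coverP hD.
have memB c K : K \in D -> (K \in B c) = ([set: sgroup c]%G \isog K).
  move=> DK; rewrite (pblock_equivalence_partition isogS_equiv) ?hD //.
  by rewrite /isogS -(isog_transl _ (hP c)).
rewrite -card_structure_consts -cardsT; apply/andP; split.
  apply: leq_trans (leq_imset_card B _); apply/subset_leq_card/subsetP => X PX.
  have /set0Pn[K XK] : X != set0 by apply: contraNneq ntP => <-.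
  have DK : K \in D by rewrite -coverP; apply/bigcupP; exists X.
  have := DK; rewrite inE => /and3P[/eqP oK pK /asboolP tK].
  have [c cK] := type2_sgroup_isog oK pK tK.
  apply/imsetP; exists c => //; apply/esym/def_pblock => //.
  rewrite -(def_pblock trivP PX XK) (pblock_equivalence_partition isogS_equiv) ?hD //.
  by rewrite /isogS -(isog_transl _ cK).
(* The arrays are counted fibre by fibre; a nonempty fibre consists of arrays whose groups are
   isomorphic to that of a fixed [c0]. *)
rewrite -sum1_card (partition_big B (mem Pn)) /= => [|c _]; last exact: BP.
rewrite -sum_nat_const; apply: leq_sum => X PX; rewrite sum1_card.
have [c0 /eqP Bc0|noc] := pickP (fun c => B c == X); last first.
  by rewrite eq_card0 // => c; rewrite unfold_in /= noc andbF.
apply: leq_trans (card_isog_sgroup c0); apply/subset_leq_card/subsetP => c.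
rewrite inE unfold_in /= inE => /eqP Bc; rewrite (isog_transr _ (hP c0)) -memB ?hD //.
by rewrite Bc -Bc0 memB ?hD.
Qed.

End Counting.

(* Asymptotics of the exponent *)
From mathcomp Require Import all_classical all_reals all_analysis.
From mathcomp Require Import lra.
Import Order.TTheory GRing.Theory Num.Theory numFieldNormedType.Exports.

Local Open Scope classical_set_scope.
Local Open Scope ring_scope.

(** For [d > 0], [n ^ 2 <= d * n ^ 3] as soon as [n >= d^-1]. *)
Lemma littleo_quad_cube (R : realType) (e : nat -> R) :
  (forall n, `|e n| <= n%:R ^+ 2) -> e =o_\oo (fun n : nat => n%:R ^+ 3 : R).
Proof.
move=> e_le; apply/eqoP => _/posnumP[d].
near=> n; apply: le_trans (e_le n) _.
rewrite ger0_norm ?exprn_ge0 // exprS mulrA ler_peMl ?exprn_ge0 //.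
rewrite -ler_pdivrMl // mulr1; near: n; exact: nbhs_infty_ger.
Unshelve. all: by end_near.
Qed.

Lemma powR_ln_div (R : realType) (a b : R) :
  1 < a -> 0 < b -> a `^ (ln b / ln a) = b.
Proof.
move=> a_gt1 b_gt0; have a_gt0 : 0 < a by apply: lt_trans a_gt1.
by rewrite /powR gt_eqF // divfK ?lnK // gt_eqF // ln_gt0.
Qed.

(** Used with [x = r], [2 * x = n] and [l] the base-[p] logarithm of the count. The main term is
    [x ^ 3 / 2], and the error lies between [- 5 / 2 * x ^ 2] and [- x ^ 2 / 2]. *)
Lemma cube_error_le (R : realFieldType) (l x : R) :
    l <= (x ^+ 3 - x ^+ 2) / 2 -> (x ^+ 3 - x ^+ 2) / 2 <= l + 2 * x ^+ 2 ->
  `|l - 16%:R^-1 * (2 * x) ^+ 3| <= (2 * x) ^+ 2.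
Proof.
have x2 : 0 <= x ^+ 2 by exact: sqr_ge0.
rewrite !exprMn; move: (x ^+ 2) (x ^+ 3) x2 => u v u0 l_hi l_lo.
by rewrite ler_norml; apply/andP; split; lra.
Qed.

Theorem mainTheorem6 (R : realType) (p : nat) (p_prime : prime p)
    (p_odd : odd p) :
  exists e : nat -> R,
    e =o_\oo (fun n : nat => n%:R ^+ 3 : R) /\
    (forall n : nat, ~~ odd n ->
      (num_powerful p n)%:R = p%:R `^ (16%:R^-1 * n%:R ^+ 3 + e n) :> R).
Proof.
pose L n : R := ln (num_powerful p n)%:R / ln p%:R.
have p_gt1 : 1 < p%:R :> R by rewrite ltr1n prime_gt1.
have lnp_gt0 : 0 < ln p%:R :> R by rewrite ln_gt0.
(* A zero count would contradict the lower bound; positivity makes [L] the exact exponent. *)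
have num_gt0 r : (0 < num_powerful p r.*2)%N.
  have /andP[_ lo] := num_powerful_bounds p_prime p_odd r.
  rewrite lt0n; apply: contraTneq lo => ->; rewrite mul0n -ltnNge.
  by rewrite expn_gt0 prime_gt0.
(* The error is whatever the exact exponent leaves over; at odd [n] the default 0 respects the
   little-o bound. *)
exists (fun n => if odd n then 0 else L n - 16%:R^-1 * n%:R ^+ 3); split; last first.
  move=> n n_even; rewrite (negPf n_even) subrKC powR_ln_div // ltr0n.
  by rewrite -(even_halfK n_even).
apply: littleo_quad_cube => n; case: ifPn => [_|n_even].
  by rewrite normr0 exprn_ge0.
rewrite -(even_halfK n_even); set r := n./2.
have /andP[hi lo] := num_powerful_bounds p_prime p_odd r.
set m := ('C(r, 2) * r)%N in hi lo.
have m_eq : m%:R = (r%:R ^+ 3 - r%:R ^+ 2) / 2 :> R.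
  (* This form avoids truncated subtraction, so it casts directly to [R]. *)
  have : (m * 2 + r ^ 2 = r ^ 3)%N.
    have b2 : ('C(r, 2) * 2 = r * r.-1)%N by rewrite (bin_ffact r 2) ffactnS ffactn1.
    rewrite /m mulnAC b2; case: (r) => // k /=.
    by rewrite !expnS expn0 muln1 -mulnA -mulnDr -mulSnr.
  move/(congr1 (fun k => k%:R : R)); rewrite natrD natrM !natrX => <-.
  by rewrite addrK mulfK.
have num0 : 0 < (num_powerful p r.*2)%:R :> R by rewrite ltr0n num_gt0.
have p0 : 0 < p%:R :> R by rewrite ltr0n prime_gt0.
have L_hi : L r.*2 <= m%:R.
  rewrite ler_pdivrMr // mulr_natl -lnXn // ler_ln ?posrE ?exprn_gt0 //.
  by rewrite -natrX ler_nat.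
have L_lo : m%:R <= L r.*2 + (r.*2 * r)%:R.
  rewrite -lerBlDr ler_pdivlMr // mulrBl lerBlDr !mulr_natl -!lnXn //.
  rewrite -lnM ?posrE ?exprn_gt0 // ler_ln ?posrE ?mulr_gt0 ?exprn_gt0 //.
  by rewrite -!natrX -natrM ler_nat.
rewrite -mul2n -mulnA natrM mulnn natrX mul2n m_eq in L_lo; rewrite m_eq in L_hi.
have -> : r.*2%:R = 2 * r%:R :> R by rewrite -mul2n natrM.
exact: cube_error_le.
Qed.
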